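(* Consider $m$ experiments, with independent always valid p-value processes $(p^i_n)_{n\ge1}$, $i=1,\dots,m$, and let $\alpha\in(0,1)$. Let $T$ be a stopping time, let $m_0$ be the number of truly null hypotheses, and let $I$ be the set of truly null hypotheses $i$ such that $$\sum_{r=1}^m\mathbb P\Big((T_{r-1})^{-i}_0\le T<(T^+_{r-1})^{-i}_0\ \Big|\ T^i_r\le T,\ T<\infty\Big)>1.$$ Then the rejection set $S^{BH}_T$ has false discovery rate at most $$\alpha\left(\frac{m_0}{m}+\frac{|I|\sum_{k=2}^m\frac1k}{m}\right).$$ In particular, if only stopping times for which $I$ is empty are permitted, then the BH-I procedure applied to $(p^i_T)_{i=1}^m$ controls the false discovery rate at level $\alpha$.
   Context: $m$ experiments are run simultaneously; at each step one observation is made on every experiment. Experiment $i$ tests $H_0^i:\theta^i=\theta^i_0$; the hypothesis is truly null if the true parameter satisfies $\theta^i=\theta^i_0$. Stopping times are with respect to the filtration generated by the data of all experiments, and may be infinite. $(p^i_n)_n$ is an always valid p-value process if each $p_n^i$ is $[0,1]$-valued and adapted and, whenever $\theta^i=\theta^i_0$, $\mathbb P(T<\infty,\ p^i_T\le s)\le s$ for every stopping time $T$ and all $s\in[0,1]$. ''Independent'' means the $m$ processes (data streams) are mutually independent. BH-I at level $\alpha$: given p-values ordered increasingly $p^{(1)}\le\dots\le p^{(m)}$, reject hypotheses $(1),\dots,(j)$ where $j$ is maximal with $p^{(j)}\le\alpha j/m$ (none if no such $j$). Let $S^{BH}_n$ be the set of hypotheses rejected when BH-I is applied to $(p^i_n)_{i=1}^m$,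 and $R^{BH}_n=|S^{BH}_n|$. If $T=\infty$ nothing is rejected. The false discovery rate of $S^{BH}_T$ is $\mathbb E[V/\max(R,1)]$, where $R=|S^{BH}_T|$ and $V$ is the number of truly null hypotheses in $S^{BH}_T$. Define $T^i_r=\inf\{t:p^i_t\le\alpha r/m\}$. For fixed $i$, let $p^{-i}_{(1),n}\le p^{-i}_{(2),n}\le\dots$ be the ordered p-values at time $n$ of the experiments other than $i$, and let $(S^{BH}_n)^{-i}_0$ be the set of hypotheses (other than $i$) rejected by the modified procedure that rejects $(1),\dots,(k)$ with $k$ maximal such that $p^{-i}_{(k),n}\le\alpha(k+1)/m$ (these are the rejections among the other hypotheses that BH-I would make if $p^i_n=0$). Let $(R^{BH}_n)^{-i}_0=|(S^{BH}_n)^{-i}_0|$ and $$(T_r)^{-i}_0=\inf\{t:(R^{BH}_t)^{-i}_0=r\},\qquad (T^+_r)^{-i}_0=\inf\{t:(R^{BH}_t)^{-i}_0>r\}.$$ Infima of empty sets are $\infty$.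
   Formalization: The formal theorem additionally assumes that each p-value process is almost surely nonincreasing in n; without this the stated bound is false (e.g. m=2, p^1 constant uniform null, p^2 = 0,1,0,0,..., T=2 if p^1≤α/2 and T=3 otherwise gives false discovery rate 3α/4 > α/2). *)

(* Defs.v *)
From HB Require Import structures.
From mathcomp Require Import all_boot all_order all_algebra.
From mathcomp Require Import all_classical all_reals all_analysis.

Set Implicit Arguments.
Unset Strict Implicit.
Unset Printing Implicit Defensive.

Import Order.TTheory GRing.Theory Num.Theory.

Local Open Scope classical_set_scope.
Local Open Scope ring_scope.

(* Conventions.
   - Time is indexed from 0: index n stands for the (n+1)-st observation, so
     that every time n carries at least one observation of each experiment.
   - A random time is a function with values in [option nat]; [None] is the
     time infinity. *)

Section Filtration.
Context {d : measure_display} {Omega : measurableType d} {m : nat}.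
Context {dS : 'I_m -> measure_display}
        {S : forall i : 'I_m, measurableType (dS i)}.

Definition data_filtration (X : forall i : 'I_m, nat -> Omega -> S i) (n : nat) :
    set (set Omega) :=
  <<s [set A | exists i k,
         (k <= n)%N /\ preimage_set_system setT (X i k) measurable A] >>.

End Filtration.

Definition is_stopping_time {Omega : Type} (F : nat -> set (set Omega))
    (T : Omega -> option nat) : Prop :=
  forall n, F n [set w | exists2 k, T w = Some k & (k <= n)%N].

Definition process_sigma {d d' : measure_display} {Omega : measurableType d}
    {E : measurableType d'} (Y : nat -> Omega -> E) : set (set Omega) :=
  <<s [set A | exists n, preimage_set_system setT (Y n) measurable A] >>.

Definition mutually_independent {d : measure_display} {Omega : measurableType d}
    {R : realType} (P : probability Omega R) (m : nat)
    (G : 'I_m -> set (set Omega)) : Prop :=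
  forall (J : {set 'I_m}) (A : 'I_m -> set Omega),
    (forall i, i \in J -> G i (A i)) ->
    P (\bigcap_(i in [set` J]) A i) = (\prod_(i in J) P (A i))%E.

(* [null] is the assertion that the tested hypothesis is true under [P]. *)
Definition always_valid {d : measure_display} {Omega : measurableType d}
    {R : realType} (P : probability Omega R) (F : nat -> set (set Omega))
    (null : Prop) (p : nat -> Omega -> R) : Prop :=
  [/\ forall n w, 0 <= p n w <= 1,
      forall n (B : set R), measurable B -> F n (p n @^-1` B) &
      null -> forall T, is_stopping_time F T ->
        forall s : R, 0 <= s <= 1 ->
        (P [set w | exists2 n, T w = Some n & (p n w <= s)%R] <= s%:E)%E ].

Section StepUp.
Context {R : realType} {m : nat}.

(* [step_up c q s] orders the hypotheses listed in [s] by increasing p-value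
   [q] and rejects the first j of them, where j is the largest index in
   1 .. size s such that the j-th smallest p-value is at most [c j] (and
   j = 0 if there is none). When [c] is nondecreasing on positive indices the
   way ties are ordered is irrelevant: the rejected set never separates equal
   p-values. *)
Definition by_pvalue (q : 'I_m -> R) (s : seq 'I_m) : seq 'I_m :=
  sort (fun a b => q a <= q b) s.

Definition ord_pvalue (q : 'I_m -> R) (s : seq 'I_m) (j : nat) : R :=
  nth 0 [seq q a | a <- by_pvalue q s] j.-1.

Definition step_up_index (c : nat -> R) (q : 'I_m -> R) (s : seq 'I_m) : nat :=
  \max_(j < (size s).+1 | (0 < j)%N && (ord_pvalue q s j <= c j)) j.

Definition step_up (c : nat -> R) (q : 'I_m -> R) (s : seq 'I_m) : {set 'I_m} :=
  [set:: take (step_up_index c q s) (by_pvalue q s)].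

Definition BH (alpha : R) (q : 'I_m -> R) : {set 'I_m} :=
  step_up (fun j => alpha * j%:R / m%:R) q (enum 'I_m).

Definition BH_except (alpha : R) (i : 'I_m) (q : 'I_m -> R) : {set 'I_m} :=
  step_up (fun k => alpha * k.+1%:R / m%:R) q [seq j <- enum 'I_m | j != i].

End StepUp.

Section Times.
Context {R : realType}.

Definition time_val (t : option nat) : \bar R :=
  if t is Some n then n%:R%:E else +oo%E.

Definition first_time (Q : nat -> Prop) : \bar R :=
  ereal_inf [set t%:R%:E | t in [set t : nat | Q t]].

End Times.

(* The quotient is 0 when the conditioning event [B] has probability 0. *)
Definition cond_prob {d : measure_display} {Omega : measurableType d}
    {R : realType} (P : probability Omega R) (A B : set Omega) : R :=
  fine (P (A `&` B)) / fine (P B).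

Section Experiments.
Context {d : measure_display} {Omega : measurableType d} {R : realType}.
Context {m : nat}.
Implicit Types (p : 'I_m -> nat -> Omega -> R) (T : Omega -> option nat).

Definition hit_pvalue (alpha : R) p (i : 'I_m) (r : nat) (w : Omega) : \bar R :=
  first_time (fun t => p i t w <= alpha * r%:R / m%:R).

Definition num_except (alpha : R) p (i : 'I_m) (t : nat) (w : Omega) : nat :=
  #|BH_except alpha i (fun j => p j t w)|.

Definition hit_except (alpha : R) p (i : 'I_m) (r : nat) (w : Omega) : \bar R :=
  first_time (fun t => num_except alpha p i t w = r).

Definition hit_except_plus (alpha : R) p (i : 'I_m) (r : nat) (w : Omega) :
    \bar R :=
  first_time (fun t => (r < num_except alpha p i t w)%N).

Definition bad_nulls (P : probability Omega R) (alpha : R) p T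
    (null : {set 'I_m}) : {set 'I_m} :=
  [set i in null |
    1 < \sum_(1 <= r < m.+1)
          cond_prob P
            [set w | (hit_except alpha p i r.-1 w <= time_val (T w))%E /\
                     (time_val (T w) < hit_except_plus alpha p i r.-1 w)%E]
            [set w | (hit_pvalue alpha p i r w <= time_val (T w))%E /\
                     (time_val (T w) < +oo :> \bar R)%E] ]%SET.

Definition BH_at (alpha : R) p T (w : Omega) : {set 'I_m} :=
  if T w is Some n then BH alpha (fun i => p i n w) else finset.set0.

Definition false_discovery_prop (null S : {set 'I_m}) : R :=
  #|S :&: null|%:R / (maxn #|S| 1)%:R.

Definition FDR (P : probability Omega R) (null : {set 'I_m})
    (rejected : Omega -> {set 'I_m}) : \bar R :=
  ('E_P[fun w => false_discovery_prop null (rejected w)])%E.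

End Experiments.

Definition true_nulls {m : nat} {Theta : 'I_m -> Type}
    (theta theta0 : forall i, Theta i) : {set 'I_m} :=
  [set i | `[< theta i = theta0 i >] ]%SET.

(* Main.v *)
Require Import Defs.
From HB Require Import structures.
From mathcomp Require Import all_boot all_order all_algebra.
From mathcomp Require Import all_classical all_reals all_analysis.
From mathcomp Require Import ring.

Set Implicit Arguments.
Unset Strict Implicit.
Unset Printing Implicit Defensive.

Import Order.TTheory GRing.Theory Num.Theory.
(* Without this second import of [measurable_realfun], the measurable structure
   of [\bar R] is not found. *)
Import measurable_realfun HBNNSimple.

Local Open Scope classical_set_scope.
Local Open Scope ring_scope.

(* Almost surely the p-values decrease in time, so if BH at time [T] rejects the
   true null [i] and makes [r] rejections in all, then the event [B i r] that
   [p i] reached level [alpha r / m] by time [T] occurs, and so does the event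
   [A i r] that the modified count for the other experiments is [r - 1]. Hence
   the FDR is at most the sum over true nulls [i] and over [r] of
   [P (A i r `&` B i r) / r], where [P (B i r) <= alpha r / m] by validity.
   If the conditional probabilities [P (A i r | B i r)] sum to at most 1 over
   [r], the inner sum is at most [alpha / m]. In every case, as the [A i r] are
   disjoint and the [B i r] increase with [r], it is at most [alpha / m] times
   the m-th harmonic number. *)

(** * Step-up procedures expressed through counts of small p-values *)

Lemma sorted_nth_le_count (R : realType) (u : seq R) (j : nat) (x : R) :
  sorted <=%R u -> (j < size u)%N ->
  (nth 0 u j <= x) = (j < count (fun y => (y <= x)%R) u)%N.
Proof.
elim: u j => [//|y u IHu] j /= yu; rewrite ltnS => ju.
have [yx|xy] /= := leP y x.
  case: j ju => [|j] ju /=; first by rewrite yx.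
  by rewrite add1n ltnS IHu// (path_sorted yu).
have c0 : count (fun z => (z <= x)%R) u = 0%N.
  apply/eqP; rewrite -leqn0 leqNgt -has_count; apply/hasPn => z zu.
  rewrite -ltNge (lt_le_trans xy)//.
  by have /allP/(_ z zu) := order_path_min le_trans yu.
rewrite c0 ltn0; case: j ju => [|j] ju /=; first by rewrite leNgt xy.
by rewrite IHu ?(path_sorted yu)// c0.
Qed.

Section StepUpTheory.
Context {R : realType} {m : nat}.
Implicit Types (c : nat -> R) (q : 'I_m -> R) (s : seq 'I_m).

Lemma sorted_by_pvalue q s : sorted <=%R [seq q a | a <- by_pvalue q s].
Proof.
by rewrite sorted_map; apply: sort_sorted => a b; exact: le_total.
Qed.

(** Trades order statistics for counts, so that later arguments never look at the sorted list or at
    the order of ties. *)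
Lemma ord_pvalue_le_count q s (j : nat) (x : R) : (0 < j <= size s)%N ->
  (ord_pvalue q s j <= x) = (j <= count (fun a => (q a <= x)%R) s)%N.
Proof.
case: j => // j /= js; rewrite /ord_pvalue /= sorted_nth_le_count.
- by rewrite count_map /by_pvalue count_sort.
- exact: sorted_by_pvalue.
- by rewrite size_map size_sort.
Qed.

Lemma step_up_index_size c q s : (step_up_index c q s <= size s)%N.
Proof. by apply/bigmax_leqP => j _; rewrite -ltnS. Qed.

(** With [leq_step_up_index] this characterises the step-up index as the largest [j] such that at
    least [j] p-values are at most [c j]. *)
Lemma step_up_index_count c q s (j := step_up_index c q s) :
  (j <= count (fun a => (q a <= c j)%R) s)%N.
Proof.
rewrite {}/j; have [->//|j0] := posnP (step_up_index c q s).
rewrite -ord_pvalue_le_count ?j0 ?step_up_index_size//.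
(* The implication from [0 < j] to [ord_pvalue q s j <= c j] holds for [j = 0] and for every index
   in the range, and passes to maxima. *)
move: j0; rewrite /step_up_index; elim/big_ind : _ => //.
- by move=> a b ha hb; rewrite /maxn; case: ifP.
- by move=> i /andP[].
Qed.

Lemma leq_step_up_index c q s (j : nat) :
  (j <= count (fun a => (q a <= c j)%R) s)%N -> (j <= step_up_index c q s)%N.
Proof.
have [->//|j0 jc] := posnP j.
have js : (j < (size s).+1)%N by rewrite ltnS (leq_trans jc)// count_size.
apply: (@leq_bigmax_cond _ _ (fun i : 'I_(size s).+1 => i : nat) (Ordinal js)).
by rewrite /= j0 ord_pvalue_le_count// j0.
Qed.

(** Only comparisons of p-values with thresholds matter. This gives monotonicity in time and,
    applied in both directions, measurability of the number of rejections. *)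
Lemma step_up_index_homo c q q' s :
  (forall a k, (k <= size s)%N -> q a <= c k -> q' a <= c k) ->
  (step_up_index c q s <= step_up_index c q' s)%N.
Proof.
move=> qq'; apply: leq_step_up_index.
apply: leq_trans (step_up_index_count c q s) _; apply: sub_count => a.
exact/qq'/step_up_index_size.
Qed.

Lemma card_step_up c q s : uniq s -> #|step_up c q s| = step_up_index c q s.
Proof.
move=> us; rewrite cardsE; apply: etrans (card_uniqP _) _.
  by rewrite take_uniq// sort_uniq.
by rewrite size_takel// size_sort step_up_index_size.
Qed.

(** A rejected hypothesis stands among the first [j] of the sorted list, so its p-value is at most
    the [j]-th smallest, which is at most [c j]. *)
Lemma step_up_pvalue_le c q s a : a \in step_up c q s ->
  q a <= c (step_up_index c q s).
Proof.
rewrite inE; set j := step_up_index c q s; set t := by_pvalue q s => aj.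
have jt : (j <= size t)%N by rewrite size_sort step_up_index_size.
have it : (index a t < j)%N by rewrite -in_take_leq.
have at_ : a \in t by exact: mem_take aj.
have j0 : (0 < j)%N by exact: leq_ltn_trans it.
have : ord_pvalue q s j <= c j.
  by rewrite ord_pvalue_le_count ?step_up_index_count// j0 step_up_index_size.
apply: le_trans; rewrite /ord_pvalue -/t -[in leLHS](nth_index a at_).
rewrite -(nth_map a 0 q) ?index_mem//.
apply: (sorted_leq_nth le_trans le_refl) => //.
- exact: sorted_by_pvalue.
- by rewrite inE size_map index_mem.
- by rewrite inE size_map prednK.
- by rewrite -ltnS prednK.
Qed.

End StepUpTheory.

(** For every level [x >= q i], dropping [i] lowers the number of p-values at most [x] by exactly
    one, and the shift of the thresholds makes up for it. An index [k >= j] for the other hypotheses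
    would therefore yield the index [k + 1] for all of them, against the maximality of [j]. *)
Lemma step_up_index_except (R : realType) (m : nat) (c : nat -> R)
    (q : 'I_m -> R) (i : 'I_m) (j := step_up_index c q (enum 'I_m)) :
  {homo c : a b / (a <= b)%N >-> a <= b} -> (0 < j)%N -> q i <= c j ->
  step_up_index (fun k => c k.+1) q [seq a <- enum 'I_m | a != i] = j.-1.
Proof.
move=> c_homo j0 qij; set s' := [seq a <- _ | _].
have cnt (x : R) : q i <= x ->
    count (fun a => q a <= x)%R (enum 'I_m) = (count (fun a => q a <= x)%R s').+1.
  move=> qix; have /permP-> := perm_to_rem (mem_enum 'I_m i).
  by rewrite rem_filter ?enum_uniq//= qix.
apply/eqP; rewrite eqn_leq; apply/andP; split.
- set k := step_up_index _ _ _.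
  have [->//|k0] := posnP k; rewrite -ltnS prednK//.
  apply: contraT; rewrite -leqNgt => jk.
  have : (k.+1 <= j)%N.
    apply: leq_step_up_index; rewrite cnt ?ltnS ?step_up_index_count//.
    by apply: le_trans qij _; exact: c_homo (leqW jk).
  by rewrite ltnNge jk.
- apply: leq_step_up_index; rewrite prednK//.
  by rewrite -ltnS prednK// -cnt// step_up_index_count.
Qed.

(** * First hitting times compared with a finite time *)

Section FirstTime.
Context {R : realType}.
Implicit Type Q : nat -> Prop.

Lemma first_time_le Q (n : nat) :
  (first_time Q <= n%:R%:E :> \bar R)%E <-> exists2 t, (t <= n)%N & Q t.
Proof.
split=> [Qn|[t tn Qt]]; last first.
  apply: le_trans (ereal_inf_lbound _) _; first by exists t.
  by rewrite lee_fin ler_nat.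
apply: contrapT => nQ; move: Qn; rewrite leNgt => /negP; apply.
(* If [Q] fails at all times up to [n], the infimum is at least [n + 1]; an empty set, with infimum
   [+oo], is included. *)
apply: (@lt_le_trans _ _ n.+1%:R%:E); first by rewrite lte_fin ltr_nat.
apply: le_ereal_inf_tmp => _ [t Qt <-]; rewrite lee_fin ler_nat ltnNge.
by apply/negP => tn; apply: nQ; exists t.
Qed.

Lemma first_time_gt Q (n : nat) :
  (n%:R%:E < first_time Q :> \bar R)%E <-> forall t, (t <= n)%N -> ~ Q t.
Proof.
rewrite ltNge; split=> [/negP nQ t tn Qt|nQ].
  by apply/nQ/first_time_le; exists t.
by apply/negP => /first_time_le[t tn]; exact: nQ.
Qed.

End FirstTime.

(** * Measurability of finitely determined and of stopped events *)

Section Measurability.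
Context {d : measure_display} {Omega : measurableType d}.

Lemma measurable_determined (I : finType) (b : I -> Omega -> bool)
    (Q : set Omega) :
  (forall i, measurable [set w | b i w]) ->
  (forall w w', (forall i, b i w = b i w') -> Q w -> Q w') ->
  measurable Q.
Proof.
move=> mb Qb.
(* [D] lists the truth patterns of the [b i] met by [Q]; [Q] is the finite union of the
   corresponding cells. *)
pose D := [set f : {ffun I -> bool} | exists2 w, Q w & forall i, f i = b i w].
have -> : Q = \bigcup_(f in D) \bigcap_i [set w | b i w = f i].
  apply/seteqP; split=> w => [Qw|[f [w' Qw' fE] /= fw]].
    exists [ffun i => b i w]; last by move=> i _ /=; rewrite ffunE.
    by exists w => // i; rewrite ffunE.
  by apply: Qb Qw' => i; rewrite -fE fw.
apply: fin_bigcup_measurable => [|f _]; first exact: finite_finset.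
apply: fin_bigcap_measurable => [|i _]; first exact: finite_finset.
case: (f i); first exact: mb.
rewrite (_ : [set w | _] = ~` [set w | b i w]); first exact: measurableC.
by apply/seteqP; split=> w /=; case: (b i w).
Qed.

Lemma data_filtration_measurable (m : nat) (dS : 'I_m -> measure_display)
    (S : forall i : 'I_m, measurableType (dS i))
    (X : forall i : 'I_m, nat -> Omega -> S i) (n : nat) :
  (forall i k, measurable_fun setT (X i k)) ->
  data_filtration X n `<=` measurable.
Proof.
move=> mX; apply: smallest_sub; first exact: sigma_algebra_measurable.
by move=> _ [i [k [_ [B mB <-]]]]; exact: mX.
Qed.

Lemma measurable_stopping_time_eq (F : nat -> set (set Omega))
    (T : Omega -> option nat) (n : nat) :
  (forall k, F k `<=` measurable) -> is_stopping_time F T ->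
  measurable [set w | T w = Some n].
Proof.
move=> mF sT; case: n => [|n].
  rewrite (_ : [set _ | _] = [set w | exists2 k, T w = Some k & (k <= 0)%N]).
    exact/mF/sT.
  apply/seteqP; split=> w /= => [->|[k ->]]; first by exists 0%N.
  by rewrite leqn0 => /eqP->.
rewrite (_ : [set _ | _] = [set w | exists2 k, T w = Some k & (k <= n.+1)%N] `\`
    [set w | exists2 k, T w = Some k & (k <= n)%N]).
  by apply: measurableD; exact/mF/sT.
apply/seteqP; split=> w /=.
  move=> ->; split; first by exists n.+1.
  by move=> [k [<-]]; rewrite ltnn.
move=> [[k Tk kn] nk]; rewrite Tk; congr Some; apply/eqP.
by rewrite eqn_leq kn ltnNge; apply/negP => kn'; apply: nk; exists k.
Qed.

Lemma measurable_stopped (T : Omega -> option nat) (Q : nat -> set Omega) :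
  (forall n, measurable [set w | T w = Some n]) ->
  (forall n, measurable (Q n)) ->
  measurable [set w | exists2 n, T w = Some n & Q n w].
Proof.
move=> mT mQ.
rewrite (_ : [set w | _] = \bigcup_n ([set w | T w = Some n] `&` Q n)).
  by apply: bigcupT_measurable => n; exact: measurableI.
by apply/seteqP; split=> w /= [n]; [exists n|move=> _ []; exists n].
Qed.

Lemma measurable_exists_le (Q : nat -> set Omega) (n : nat) :
  (forall t, measurable (Q t)) ->
  measurable [set w | exists2 t, (t <= n)%N & Q t w].
Proof.
move=> mQ; rewrite (_ : [set w | _] = \bigcup_(t in [set t | (t <= n)%N]) Q t).
  by apply: bigcup_measurable => t _.
by apply/seteqP; split=> w /= [t]; exists t.
Qed.

End Measurability.

(** * Expectations bounded by weighted sums of probabilities *)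

Section Integration.
Context {d : measure_display} {Omega : measurableType d} {R : realType}.

(** The integral of [f] is a supremum over simple functions below [f], and each of these is
    measurable and almost everywhere below [g]. It serves for the false discovery proportion, whose
    measurability is not established here. *)
Lemma ae_ge0_le_integral_nonmeas (mu : {measure set Omega -> \bar R})
    (f g : Omega -> \bar R) :
  (forall w, 0 <= f w)%E -> (forall w, 0 <= g w)%E -> measurable_fun setT g ->
  {ae mu, forall w, (f w <= g w)%E} ->
  (\int[mu]_w f w <= \int[mu]_w g w)%E.
Proof.
move=> f0 g0 mg fg; rewrite ge0_integralTE//.
apply: ge_ereal_sup => _ [h hf <-]; rewrite -integralT_nnsfun.
apply: ae_ge0_le_integral => //.
- by move=> w _; rewrite lee_fin.
- exact/measurable_EFinP/measurable_funP.
- by apply: filterS fg => w fgw _; exact: le_trans (hf w) fgw.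
Qed.

Variable P : probability Omega R.

Lemma integral_sum_indic (J : finType) (c : J -> R) (E : J -> set Omega) :
  (forall j, 0 <= c j) -> (forall j, measurable (E j)) ->
  (\int[P]_w (\sum_j c j * \1_(E j) w)%:E = (\sum_j c j * fine (P (E j)))%:E)%E.
Proof.
move=> c0 mE; under eq_integral do rewrite -sumEFin.
rewrite ge0_integral_sum//.
- rewrite -sumEFin; apply: eq_bigr => j _.
  under eq_integral do rewrite EFinM.
  rewrite ge0_integralZl ?lee_fin//.
  + by rewrite integral_indic// setIT EFinM fineK// fin_num_measure.
  + exact/measurable_EFinP/measurable_indic.
- by move=> j; apply/measurable_EFinP/measurable_funM => //; exact/measurable_indic.
- by move=> j w _; rewrite lee_fin mulr_ge0.
Qed.

Lemma measurable_sum_indic (J : finType) (c : J -> R) (E : J -> set Omega) :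
  (forall j, measurable (E j)) ->
  measurable_fun setT (fun w => (\sum_j c j * \1_(E j) w)%:E : \bar R).
Proof.
move=> mE; apply/measurable_EFinP.
apply: measurable_sum => j; apply: measurable_funM => //; exact/measurable_indic.
Qed.

Lemma ae_le_integral_sum_indic (f : Omega -> R) (J : finType) (c : J -> R)
    (E : J -> set Omega) :
  (forall w, 0 <= f w) -> (forall j, 0 <= c j) -> (forall j, measurable (E j)) ->
  {ae P, forall w, f w <= \sum_j c j * \1_(E j) w} ->
  (\int[P]_w (f w)%:E <= (\sum_j c j * fine (P (E j)))%:E)%E.
Proof.
move=> f0 c0 mE fE; rewrite -integral_sum_indic//.
apply: ae_ge0_le_integral_nonmeas => //.
- by move=> w; rewrite lee_fin sumr_ge0// => j _; rewrite mulr_ge0.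
- exact: measurable_sum_indic.
Qed.

Lemma sum_fine_indic_le (J : finType) (c c' : J -> R) (E E' : J -> set Omega) :
  (forall j, 0 <= c j) -> (forall j, 0 <= c' j) ->
  (forall j, measurable (E j)) -> (forall j, measurable (E' j)) ->
  (forall w, \sum_j c j * \1_(E j) w <= \sum_j c' j * \1_(E' j) w) ->
  \sum_j c j * fine (P (E j)) <= \sum_j c' j * fine (P (E' j)).
Proof.
move=> c0 c'0 mE mE' EE'; rewrite -lee_fin -integral_sum_indic//.
apply: ae_le_integral_sum_indic => //; last exact: aeW.
by move=> w; rewrite sumr_ge0// => j _; rewrite mulr_ge0.
Qed.

(* Summation by parts, with [u k = 1 / (k + 1)] cut off at [k = m]: on the event
   [A r `&` B r] all of [B r], ..., [B m.-1] occur, and the weights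
   [u k - u k.+1] of these add up to [u r]. *)
Lemma harmonic_disjoint_bound (m : nat) (A B : nat -> set Omega) (x : R) :
  (forall r, measurable (A r)) -> (forall r, measurable (B r)) ->
  (forall r s w, A r w -> A s w -> r = s) ->
  {homo B : r s / (r <= s)%N >-> r `<=` s} ->
  (forall r, (r < m)%N -> fine (P (B r)) <= x * r.+1%:R) ->
  \sum_(r < m) r.+1%:R^-1 * fine (P (A r `&` B r)) <=
    x * \sum_(r < m) r.+1%:R^-1.
Proof.
move=> mA mB A_inj B_homo PB.
pose u k : R := if (k < m)%N then k.+1%:R^-1 else 0.
have u_dec k : u k.+1 <= u k.
  rewrite /u; case: (ltnP k.+1 m) => km; last by case: ifP => // _; rewrite invr_ge0.
  by rewrite (ltnW km) lef_pV2 ?posrE// ler_nat.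
have uB n : (n <= m)%N -> \sum_(n <= k < m) (u k - u k.+1) = u n.
  move=> nm; rewrite (telescope_sumr_eq (fun k => - u k)) ?opprK//.
    by rewrite {1}/u ltnn oppr0 add0r.
  by move=> k _; rewrite opprK addrC.
(* At [n = m] the boundary term vanishes because [u m = 0], and what remains on the right is the
   harmonic number. *)
have abel n : \sum_(k < n) (u k - u k.+1) * k.+1%:R = \sum_(k < n) u k - u n * n%:R.
  elim: n => [|n IHn]; first by rewrite !big_ord0 mulr0 subr0.
  by rewrite !big_ord_recr/= {}IHn; ring.
have ur (r : 'I_m) : u r = r.+1%:R^-1 by rewrite /u ltn_ord.
apply: le_trans (_ : \sum_(k < m) (u k - u k.+1) * fine (P (B k)) <= _).
  apply: sum_fine_indic_le => //.
  - by move=> k; rewrite subr_ge0.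
  - by move=> k; exact: measurableI.
  (* As the [A r] are disjoint, at most one term on the left is nonzero at [w]. *)
  move=> w; have [[r Ar]|nA] := pselect (exists r : 'I_m, (A r `&` B r) w).
    rewrite (bigD1 r)//= big1 ?addr0 => [|s sr]; last first.
      rewrite indicE memNset ?mulr0// => -[As _].
      by move: sr; rewrite -val_eqE/= (A_inj _ _ _ As Ar.1) eqxx.
    rewrite indicE mem_set// mulr1 -ur -uB; last exact: ltnW.
    rewrite big_geq_mkord/= big_mkcond/=; apply: ler_sum => k _.
    have ? : 0 <= u k - u k.+1 by rewrite subr_ge0.
    case: ifP => [rk|_]; last by rewrite mulr_ge0.
    by rewrite indicE mem_set ?mulr1//; exact: B_homo Ar.2.
  rewrite big1 => [|r _]; first by rewrite sumr_ge0// => k _; rewrite mulr_ge0// subr_ge0.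
  by rewrite indicE memNset ?mulr0// => Ar; apply: nA; exists r.
apply: (@le_trans _ _ (\sum_(k < m) (u k - u k.+1) * (x * k.+1%:R))).
  by apply: ler_sum => k _; rewrite ler_wpM2l ?subr_ge0// PB.
under eq_bigr do rewrite mulrCA.
rewrite -mulr_sumr abel {2}/u ltnn mul0r subr0.
by under eq_bigr do rewrite ur.
Qed.

End Integration.

(** * Pathwise analysis of the BH procedure at a random time *)

Section StoppedBH.
Context {d : measure_display} {Omega : measurableType d} {R : realType} {m : nat}.
Variables (alpha : R) (p : 'I_m -> nat -> Omega -> R) (T : Omega -> option nat).
Hypothesis alpha0 : 0 <= alpha.

(** The events in the conditional probabilities of [bad_nulls]. Here [r] counts rejections among the
    other hypotheses, so [in_window i r] is paired with [hit_before i r.+1]. *)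
Definition in_window (i : 'I_m) (r : nat) : set Omega :=
  [set w | (hit_except alpha p i r w <= time_val (T w))%E /\
           (time_val (T w) < hit_except_plus alpha p i r w)%E].

Definition hit_before (i : 'I_m) (r : nat) : set Omega :=
  [set w | (hit_pvalue alpha p i r w <= time_val (T w))%E /\
           (time_val (T w) < +oo :> \bar R)%E].

Lemma in_windowE i r : in_window i r =
  [set w | exists2 n, T w = Some n &
     (exists2 t, (t <= n)%N & num_except alpha p i t w = r) /\
     (forall t, (t <= n)%N -> (num_except alpha p i t w <= r)%N)].
Proof.
apply/seteqP; split=> w; rewrite /in_window/=.
  (* An infinite [T] is never strictly below a first hitting time, so [T] is finite on this
     event. *)
  case: (T w) => [n|] /=; last by move=> [_]; rewrite ltNge leey.
  move=> [/first_time_le rn /first_time_gt nr]; exists n => //; split=> // t tn.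
  by rewrite leqNgt; apply/negP; exact: nr.
move=> [n -> [rn nr]]/=; split; first exact/first_time_le.
by apply/first_time_gt => t /nr tr; apply/negP; rewrite -leqNgt.
Qed.

(** On [in_window i r] the number [r] is the maximum of the modified count up to time [T]. *)
Lemma in_window_inj i r s w : in_window i r w -> in_window i s w -> r = s.
Proof.
rewrite !in_windowE => -[n Tn [[t tn tr] nr]] [n' + [[t' tn' ts] ns]].
rewrite Tn => -[nn']; subst n'.
by apply/eqP; rewrite eqn_leq -{1}tr ns//= -ts nr.
Qed.

Lemma hit_beforeE i r : hit_before i r =
  [set w | exists2 n, T w = Some n &
     exists2 t, (t <= n)%N & p i t w <= alpha * r%:R / m%:R].
Proof.
apply/seteqP; split=> w; rewrite /hit_before/=.
  case: (T w) => [n|] /=; last by rewrite ltxx => -[].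
  by move=> [/first_time_le rn _]; exists n.
by move=> [n -> rn] /=; rewrite ltry; split=> //; exact/first_time_le.
Qed.

Lemma threshold_homo : {homo (fun k => alpha * k%:R / m%:R : R) : a b /
  (a <= b)%N >-> a <= b}.
Proof. by move=> a b ab; rewrite ler_wpM2r// ler_wpM2l// ler_nat. Qed.

Lemma hit_before_homo i : {homo hit_before i : r s / (r <= s)%N >-> r `<=` s}.
Proof.
move=> r s rs w; rewrite !hit_beforeE => -[n Tn [t tn ptr]].
by exists n => //; exists t => //; exact: le_trans ptr (threshold_homo rs).
Qed.

Lemma num_exceptE i t w : num_except alpha p i t w =
  step_up_index (fun k => alpha * k.+1%:R / m%:R) (fun j => p j t w)
    [seq j <- enum 'I_m | j != i].
Proof. by rewrite /num_except card_step_up// filter_uniq// enum_uniq. Qed.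

Lemma size_enum_except (i : 'I_m) : (size [seq j <- enum 'I_m | j != i] <= m)%N.
Proof. by rewrite size_filter -[leqRHS](size_enum_ord m) count_size. Qed.

Hypothesis p_meas : forall i n, measurable_fun setT (p i n).
Hypothesis T_meas : forall n, measurable [set w | T w = Some n].

Lemma measurable_pvalue_le i n x : measurable [set w | p i n w <= x].
Proof.
rewrite (_ : [set w | _] = setT `&` p i n @^-1` `]-oo, x]).
  by apply: p_meas => //; exact: measurable_itv.
by rewrite setTI; apply/seteqP; split=> w /=; rewrite in_itv.
Qed.

(** The count is determined by the finitely many comparisons of the p-values at time [t] with the
    thresholds [alpha * k.+1 / m], [k <= m]. *)
Lemma measurable_num_except i t (Q : nat -> Prop) :
  measurable [set w | Q (num_except alpha p i t w)].
Proof.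
apply: (measurable_determined (I := ('I_m * 'I_m.+1)%type)
  (b := fun ak w => p ak.1 t w <= alpha * ak.2.+1%:R / m%:R)).
  by move=> [a k] /=; exact: measurable_pvalue_le.
move=> w w' ww' /=; congr (Q _); rewrite !num_exceptE.
have ww'E a k : (k <= size [seq j <- enum 'I_m | j != i])%N ->
    (p a t w <= alpha * k.+1%:R / m%:R) = (p a t w' <= alpha * k.+1%:R / m%:R).
  move=> km; have km' : (k < m.+1)%N by rewrite ltnS (leq_trans km)// size_enum_except.
  exact: (ww' (a, Ordinal km')).
by apply/eqP; rewrite eqn_leq; apply/andP; split; apply: step_up_index_homo => a k km;
  rewrite ww'E.
Qed.

Lemma measurable_in_window i r : measurable (in_window i r).
Proof.
rewrite in_windowE; apply: measurable_stopped => // n.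
apply: measurableI.
  by apply: measurable_exists_le => t; exact: (measurable_num_except i t (eq^~ r)).
have mB : measurable (\bigcap_(t in [set t | (t <= n)%N])
    [set w | (num_except alpha p i t w <= r)%N]); last exact: mB.
apply: bigcap_measurable => [|t _]; first by exists 0%N.
exact: (measurable_num_except i t (fun k => (k <= r)%N)).
Qed.

Lemma measurable_hit_before i r : measurable (hit_before i r).
Proof.
rewrite hit_beforeE; apply: measurable_stopped => // n.
by apply: measurable_exists_le => t; exact: measurable_pvalue_le.
Qed.

(** Since [p i] is at most the threshold for [r] rejections at time [T], leaving [i] out gives the
    count [r - 1] there. Decreasing p-values make this count nondecreasing in time, so it has not
    exceeded [r - 1] earlier; time [T] itself witnesses both hits. *)
Lemma BH_at_mem w i :
  (forall j n, p j n.+1 w <= p j n w) -> i \in BH_at alpha p T w ->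
  let r := #|BH_at alpha p T w| in
  (0 < r)%N /\ (in_window i r.-1 `&` hit_before i r) w.
Proof.
move=> p_dec; rewrite /setI/= in_windowE hit_beforeE /BH_at.
case Tw : (T w) => [n|]; last by rewrite inE.
move=> iS /=; have r0 : (0 < #|BH alpha (fun i => p i n w)|)%N.
  by rewrite card_gt0; apply/set0Pn; exists i.
have p_homo j t : (t <= n)%N -> p j n w <= p j t w.
  exact: (@nonincreasing_seqP _ _ (fun k => p j k w)).1.
move: (step_up_pvalue_le iS) r0; rewrite /BH card_step_up ?enum_uniq//.
set r := step_up_index _ _ _ => pr r0.
have rE : num_except alpha p i n w = r.-1.
  rewrite num_exceptE.
  exact: (step_up_index_except (c := fun k => alpha * k%:R / m%:R) threshold_homo).
split=> //; split; exists n => //; last by exists n.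
split; first by exists n.
move=> t tn; rewrite -rE !num_exceptE; apply: step_up_index_homo => a k _.
exact/le_trans/p_homo.
Qed.

(** With [R] rejections in all, a rejected true null [i] contributes [1 / R], which is the term of
    index [(i, R - 1)] on the right; all other terms are nonnegative. *)
Lemma false_discovery_prop_le (H0 : {set 'I_m}) w :
  (forall j n, p j n.+1 w <= p j n w) ->
  false_discovery_prop H0 (BH_at alpha p T w) <=
  \sum_(ir : 'I_m * 'I_m) (ir.1 \in H0)%:R / ir.2.+1%:R *
     \1_(in_window ir.1 ir.2 `&` hit_before ir.1 ir.2.+1) w :> R.
Proof.
move=> p_dec; rewrite /false_discovery_prop; set S := BH_at _ _ _ _.
rewrite -(pair_bigA_idem (addr0 _) (fun i r : 'I_m => (i \in H0)%:R / r.+1%:R *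
     \1_(in_window i r `&` hit_before i r.+1) w : R))/=.
rewrite -sum1_card natr_sum mulr_suml big_mkcond/=; apply: ler_sum => i _.
have ge0 (r : 'I_m) : 0 <= (i \in H0)%:R / r.+1%:R *
    \1_(in_window i r `&` hit_before i r.+1) w :> R by rewrite !mulr_ge0.
rewrite inE; case: ifP => [/andP[iS iH]|_]; last exact: sumr_ge0.
have [r0 ABr] := BH_at_mem p_dec iS.
have rm : (#|S|.-1 < m)%N by rewrite prednK// -[leqRHS]card_ord max_card.
rewrite (bigD1 (Ordinal rm))//= ler_wpDr ?sumr_ge0//.
by rewrite iH indicE mem_set prednK// mulr1 (maxn_idPl r0).
Qed.

End StoppedBH.

(** If [P B = 0] the quotient is 0 by convention, and the left side is 0 too because the
    intersection lies in [B]. *)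
Lemma cond_probM (d : measure_display) (Omega : measurableType d) (R : realType)
    (P : probability Omega R) (A B : set Omega) :
  measurable A -> measurable B ->
  fine (P (A `&` B)) = cond_prob P A B * fine (P B).
Proof.
move=> mA mB; rewrite /cond_prob.
have [PB0|PB0] := eqVneq (fine (P B)) 0; last by rewrite divfK.
rewrite PB0 mulr0; apply/eqP; rewrite eq_le fine_ge0// andbT -PB0.
rewrite fine_le ?fin_num_measure//; first exact: measurableI.
by apply: le_measure; rewrite ?inE//; exact: measurableI.
Qed.

(** * Probability bounds for a single valid p-value process *)

Section TimeUniform.
Context {d : measure_display} {Omega : measurableType d} {R : realType} {m : nat}.
Variables (P : probability Omega R) (alpha : R) (p : 'I_m -> nat -> Omega -> R).
Variables (T : Omega -> option nat) (i : 'I_m).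
Hypothesis alpha01 : 0 < alpha < 1.
Hypothesis p_meas : forall i n, measurable_fun setT (p i n).
Hypothesis T_meas : forall n, measurable [set w | T w = Some n].
Hypothesis p_dec : forall n, {ae P, forall w, p i n.+1 w <= p i n w}.
Hypothesis p_valid : forall s : R, 0 <= s <= 1 ->
  (P [set w | exists2 n, T w = Some n & (p i n w <= s)%R] <= s%:E)%E.

Let pr (r : nat) : R :=
  fine (P (in_window alpha p T i r `&` hit_before alpha p T i r.+1)).

Lemma prob_hit_before r : (r < m)%N ->
  fine (P (hit_before alpha p T i r.+1)) <= alpha / m%:R * r.+1%:R.
Proof.
have /andP[a0 a1] := alpha01.
move=> rm; rewrite mulrAC; set s := _ / _.
have m0 : (0 : R) < m%:R by rewrite ltr0n (leq_ltn_trans _ rm).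
have s01 : 0 <= s <= 1.
  rewrite divr_ge0 ?mulr_ge0 ?(ltW a0)//= ler_pdivrMr// ler_pM ?(ltW a0) ?(ltW a1)//.
  by rewrite ler_nat.
pose E := [set w | exists2 n, T w = Some n & (p i n w <= s)%R].
have mE : measurable E.
  by apply: measurable_stopped => // n; exact: measurable_pvalue_le.
have mB := measurable_hit_before alpha p_meas T_meas i r.+1.
apply: (@le_trans _ _ (fine (P E))); last first.
  by rewrite -lee_fin fineK ?fin_num_measure//; exact: p_valid.
rewrite -lee_fin !fineK ?fin_num_measure//.
(* [N] is a null set containing every outcome at which [p i] fails to decrease. Outside [N], a level
   reached before [T] is still respected at [T], so validity at the single time [T] suffices. *)
have [N [mN PN0 pN]] := ae_foralln p_dec.
apply: (@le_trans _ _ (P (E `|` N))); last first.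
  by rewrite -[leRHS]adde0 -PN0; exact: measureU2.
apply: le_measure; rewrite ?inE//; first exact: measurableU.
rewrite hit_beforeE => w [n Tn [t tn pts]].
have [Nw|/contrapT pw] := pselect (~ forall n, p i n.+1 w <= p i n w).
  by right; exact: pN.
left; exists n => //; apply: le_trans pts.
exact: ((@nonincreasing_seqP _ _ (fun k => p i k w)).1 pw).
Qed.

(** The bound [alpha * r.+1 / m] on the conditioning event cancels the weight [1 / r.+1], leaving
    [alpha / m] times the sum of the conditional probabilities. *)
Lemma weighted_prob_cond :
  \sum_(r < m) cond_prob P (in_window alpha p T i r) (hit_before alpha p T i r.+1)
    <= 1 ->
  \sum_(r < m) r.+1%:R^-1 * pr r <= alpha / m%:R.
Proof.
have /andP[a0 a1] := alpha01.
have am0 : 0 <= alpha / m%:R by rewrite divr_ge0// ltW.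
move=> /(ler_wpM2l am0); rewrite mulr1; apply: le_trans.
rewrite mulr_sumr; apply: ler_sum => r _.
rewrite /pr cond_probM; [|exact: measurable_in_window|exact: measurable_hit_before].
rewrite mulrCA mulrC ler_wpM2r ?divr_ge0 ?fine_ge0//.
by rewrite mulrC ler_pdivrMr// prob_hit_before.
Qed.

Lemma weighted_prob_harmonic :
  \sum_(r < m) r.+1%:R^-1 * pr r <= alpha / m%:R * \sum_(r < m) r.+1%:R^-1.
Proof.
have /andP[a0 _] := alpha01.
apply: (harmonic_disjoint_bound (A := in_window alpha p T i)
  (B := fun r => hit_before alpha p T i r.+1)).
- by move=> r; exact: measurable_in_window.
- by move=> r; exact: measurable_hit_before.
- by move=> r s w; exact: in_window_inj.
- by move=> r s rs; apply: hit_before_homo; rewrite ?ltW.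
- exact: prob_hit_before.
Qed.

End TimeUniform.

(** * Summation of the bounds over the true nulls *)

Theorem theorem5 (R : realType) (d : measure_display) (Omega : measurableType d)
    (P : probability Omega R) (m : nat)
    (dS : 'I_m -> measure_display) (S : forall i : 'I_m, measurableType (dS i))
    (X : forall i : 'I_m, nat -> Omega -> S i)
    (Theta : 'I_m -> Type) (theta theta0 : forall i : 'I_m, Theta i)
    (p : 'I_m -> nat -> Omega -> R) (alpha : R) (T : Omega -> option nat)
    (X_meas : forall (i : 'I_m) (n : nat), measurable_fun setT (X i n))
    (X_indep : mutually_independent P (fun i => process_sigma (X i)))
    (p_indep : mutually_independent P (fun i => process_sigma (p i)))
    (p_valid : forall i : 'I_m,
       always_valid P (data_filtration X) (theta i = theta0 i) (p i))
    (p_noninc : forall (i : 'I_m) (n : nat),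
       {ae P, forall w, p i n.+1 w <= p i n w})
    (alpha01 : 0 < alpha < 1)
    (T_stop : is_stopping_time (data_filtration X) T) :
  let H0 := true_nulls theta theta0 in
  let m0 := #|H0| in
  let I := bad_nulls P alpha p T H0 in
  ((FDR P H0 (BH_at alpha p T) <=
     (alpha * (m0%:R / m%:R
               + #|I|%:R * (\sum_(2 <= k < m.+1) k%:R^-1) / m%:R))%:E)%E
   /\
   (I = finset.set0 -> (FDR P H0 (BH_at alpha p T) <= alpha%:E)%E)).
Proof.
move=> H0 m0 I.
have /andP[a0 a1] := alpha01.
have am0 : 0 <= alpha / m%:R by rewrite divr_ge0// ltW.
have mF n : data_filtration X n `<=` measurable by exact: data_filtration_measurable.
have mT n : measurable [set w | T w = Some n].
  exact: measurable_stopping_time_eq T_stop.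
have mp i n : measurable_fun setT (p i n).
  move=> _ B mB; rewrite setTI; have [_ pF _] := p_valid i.
  exact: mF (pF n B mB).
pose L : R := \sum_(2 <= k < m.+1) k%:R^-1.
pose pr (i : 'I_m) (r : nat) : R :=
  fine (P (in_window alpha p T i r `&` hit_before alpha p T i r.+1)).
(* One formula for both cases: the factor is [1] outside [I], and inside [I] it is [1 + L], the
   [m]-th harmonic number. *)
have pr_le i : i \in H0 ->
    \sum_(r < m) r.+1%:R^-1 * pr i r <= alpha / m%:R * (1 + (i \in I)%:R * L).
  move=> iH; have valid_i s : 0 <= s <= 1 ->
      (P [set w | exists2 n, T w = Some n & (p i n w <= s)%R] <= s%:E)%E.
    have [_ _] := p_valid i; apply=> //.
    by move: iH; rewrite inE => /asboolP.
  case: (boolP (i \in I)) => [_|].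
    rewrite mul1r; have -> : 1 + L = \sum_(r < m) r.+1%:R^-1.
      have m1 : (0 < m)%N by exact: leq_ltn_trans (ltn_ord i).
      rewrite -(big_mkord xpredT (fun r => r.+1%:R^-1)) big_ltn// invr1.
      by rewrite /L [in LHS]big_add1.
    exact: weighted_prob_harmonic.
  (* The sum in [bad_nulls] starts at [r = 1]; the shift by one matches the indexing from 0 used
     here. *)
  rewrite mul0r addr0 mulr1 inE iH/= -leNgt big_add1 big_mkord => cond_le1.
  exact: weighted_prob_cond.
have FDR_le : (FDR P H0 (BH_at alpha p T) <=
    (alpha * (m0%:R / m%:R + #|I|%:R * L / m%:R))%:E)%E.
  rewrite /FDR unlock.
  pose c (ir : 'I_m * 'I_m) : R := (ir.1 \in H0)%:R / ir.2.+1%:R.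
  pose E (ir : 'I_m * 'I_m) :=
    in_window alpha p T ir.1 ir.2 `&` hit_before alpha p T ir.1 ir.2.+1.
  apply: (@le_trans _ _ (\sum_ir c ir * fine (P (E ir)))%:E).
    apply: ae_le_integral_sum_indic => //.
    - by move=> w; rewrite divr_ge0.
    - by move=> ir; rewrite divr_ge0.
    - move=> ir; apply: measurableI.
        exact: measurable_in_window.
      exact: measurable_hit_before.
    (* Finitely many experiments and countably many times leave a single exceptional null set. *)
    have p_dec : \forall w \ae P, forall i n, p i n.+1 w <= p i n w.
      by apply: filter_forall => i; exact: ae_foralln.
    by apply: filterS p_dec => w pw; apply: false_discovery_prop_le => //; exact: ltW.
  rewrite lee_fin -(pair_bigA_idem (addr0 _) (fun i r : 'I_m =>
    (i \in H0)%:R / r.+1%:R * pr i r))/=.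
  apply: (@le_trans _ _
      (\sum_i (i \in H0)%:R * (alpha / m%:R * (1 + (i \in I)%:R * L)))).
    apply: ler_sum => i _; under eq_bigr do rewrite -mulrA.
    rewrite -mulr_sumr; case: (boolP (i \in H0)) => [iH|_]; last by rewrite !mul0r.
    by rewrite !mul1r pr_le.
  have IH0 i : (i \in I) -> (i \in H0) by rewrite inE => /andP[].
  have -> : m0%:R = \sum_i (i \in H0)%:R :> R.
    by rewrite -natr_sum /m0 -sum1_card [in LHS]big_mkcond.
  have -> : #|I|%:R = \sum_i (i \in I)%:R :> R.
    by rewrite -natr_sum -sum1_card [in LHS]big_mkcond.
  (* Both sides now agree term by term, because [I] is contained in [H0]. *)
  rewrite !mulr_suml -big_split/= mulr_sumr le_eqVlt; apply/orP; left; apply/eqP.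
  apply: eq_bigr => i _.
  case: (boolP (i \in I)) => [/IH0->|_] /=; ring.
split; first exact: FDR_le.
move=> I0; apply: le_trans FDR_le _.
rewrite lee_fin I0 cards0 !mul0r addr0 ler_piMr ?(ltW a0)//.
(* For [m = 0] the quotient [m0 / m] is 0 by the convention on inverses; otherwise [m0 <= m]. *)
have [m00|m_gt0] := posnP m; first by rewrite m00 invr0 mulr0.
rewrite ler_pdivrMr ?ltr0n// mul1r ler_nat.
by rewrite -[leqRHS]card_ord max_card.
Qed.
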